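(* For $q\in\mathsf{Q}_{12}=\{4,8,12,20,24,36,40,60,72,120,180,360\}$ let $$\hat G_\sigma^{(q)}=\left\{e^{i\frac{2\pi}{q}r}\sigma_j \;:\; j=0,1,2,3,\ r=0,1,\dots,q-1\right\}$$ be the set of phase-shifted $\sigma$-matrices. Then, for each $q\in\mathsf{Q}_{12}$, $\hat G_\sigma^{(q)}$ is, under matrix multiplication and with identity $I_2$, a finite group of order $4q$; the $12$ groups so obtained are pairwise non-isomorphic.
   Context: The $\sigma$-matrices are $\sigma_0=I_2$, $\sigma_1=\begin{pmatrix}0&1\\1&0\end{pmatrix}$, $\sigma_2=\begin{pmatrix}0&-i\\i&0\end{pmatrix}$, $\sigma_3=\begin{pmatrix}1&0\\0&-1\end{pmatrix}$. The set $\mathsf{Q}_{12}$ is the set of divisors of $360$ that are multiples of $4$. *)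

(* Defs.v *)
From HB Require Import structures.
From mathcomp Require Import all_boot all_order all_algebra.
From mathcomp Require Import all_classical all_reals all_analysis.
From mathcomp Require Import complex.

Set Implicit Arguments.
Unset Strict Implicit.
Unset Printing Implicit Defensive.

Import Order.TTheory GRing.Theory Num.Theory.

Local Open Scope classical_set_scope.
Local Open Scope ring_scope.
Local Open Scope complex_scope.

(* mathcomp's groupType would require G to be a type; here G is a set of
   elements of T and op is only used on G. *)
Definition is_group {T : Type} (op : T -> T -> T) (e : T) (G : set T) : Prop :=
  [/\ {in G &, forall x y, op x y \in G},
      {in G & &, forall x y z, op x (op y z) = op (op x y) z},
      e \in G,
      {in G, forall x, op e x = x /\ op x e = x}
    & {in G, forall x, exists2 y, y \in G & op x y = e /\ op y x = e}].

(* Only the restriction of f to G matters. *)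
Definition isomorphic {T U : Type} (opT : T -> T -> T) (opU : U -> U -> U)
    (G : set T) (H : set U) : Prop :=
  exists2 f : T -> U, set_bij G H f &
    {in G &, forall x y, f (opT x y) = opU (f x) (f y)}.

(* e^(x + iy) = e^x (cos y + i sin y); the library has no complex exponential. *)
Definition cexp {R : realType} (z : R[i]) : R[i] :=
  (expR (complex.Re z))%:C * (cos (complex.Im z) +i* sin (complex.Im z)).

Definition mx2 {R : realType} (a b c d : R[i]) : 'M[R[i]]_2 :=
  \matrix_(k < 2, l < 2) (nth [::] [:: [:: a; b]; [:: c; d]] k)`_l.

Definition sigma {R : realType} (j : 'I_4) : 'M[R[i]]_2 :=
  [:: 1%:M; mx2 0 1 1 0; mx2 0 (- 'i%C) 'i%C 0; mx2 1 0 0 (- 1)]`_j.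

Definition Q12 : pred nat := [pred q | (4 %| q)%N && (q %| 360)%N].

Definition Gsigma (R : realType) (q : nat) : set 'M[R[i]]_2 :=
  [set M | exists (j : 'I_4) (r : 'I_q),
     M = cexp ('i%C * (2 * pi / q%:R * r%:R)%:C) *: sigma j].
Arguments Gsigma : clear implicits.

(* Main.v *)
(** Put [w = exp(2 pi i / q)], a primitive [q]-th root of unity. As [4 | q], the
    unit [i] is a power of [w]; since the product of two sigma-matrices is a
    sigma-matrix up to a power of [i], the matrices [w^r sigma_j] form a group.
    The four sigma-matrices are pairwise non-proportional, so the order is
    [4 q], and groups of different orders are not isomorphic. *)
Require Import Defs.
From mathcomp Require Import all_boot all_order all_algebra.
From mathcomp Require Import all_classical all_reals all_analysis.
From mathcomp Require Import complex ring lra.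

Set Implicit Arguments.
Unset Strict Implicit.
Unset Printing Implicit Defensive.

Import Order.TTheory GRing.Theory Num.Theory.

Local Open Scope classical_set_scope.
Local Open Scope ring_scope.
Local Open Scope complex_scope.

Lemma mem_Q12 : Q12 =i [:: 4; 8; 12; 20; 24; 36; 40; 60; 72; 120; 180; 360]%N.
Proof.
move=> q; apply/idP/idP => [/andP[q4 q360]|].
  have : q \in divisors 360 by rewrite -dvdn_divisors.
  (* The list [divisors 360] is finite, so the inclusion is settled by computation. *)
  have /allP : all (fun n => (4 %| n)%N ==>
    (n \in [:: 4; 8; 12; 20; 24; 36; 40; 60; 72; 120; 180; 360]%N))
    (divisors 360) by vm_compute.
  by move=> /[apply]; rewrite q4.
by apply: (allP (_ : all Q12 _)); vm_compute.
Qed.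

Lemma set_bij_card_eq (T U : Type) (A : set T) (B : set U) (f : T -> U) :
  set_bij A B f -> (A #= B)%card.
Proof. by move=> /Pbij[g _]; exact: pcard_eq g. Qed.

(** * Roots of unity on the complex unit circle *)

Section UnitCircle.
Variable R : realType.
Implicit Types t u : R.

Definition cis t : R[i] := cos t +i* sin t.

Lemma cexp_imaginary t : cexp ('i%C * t%:C) = cis t.
Proof.
rewrite /cexp /cis /= !(mul0r, mul1r, mulr0, subr0, addr0, add0r) oppr0 expR0.
by rewrite mul1r.
Qed.

Lemma cis0 : cis 0 = 1.
Proof. by rewrite /cis cos0 sin0. Qed.

Lemma cisD t u : cis (t + u) = cis t * cis u.
Proof.
by rewrite /cis cosD sinD addrC [sin t * _ + _]addrC [- _ + _]addrC.
Qed.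

Lemma cisMn t n : cis (t *+ n) = cis t ^+ n.
Proof. by elim: n => [|n IHn]; rewrite ?cis0 // mulrS cisD IHn exprS. Qed.

Lemma cis_pihalf : cis (pi / 2) = 'i%C.
Proof. by rewrite /cis cos_pihalf sin_pihalf. Qed.

(** Half-angle argument: [cos t = 1 - 2 sin(t/2)^2], and [sin (t / 2)] is positive because [t / 2]
    lies strictly between 0 and [pi]. *)
Lemma cis_neq1 t : 0 < t < 2 * pi -> cis t != 1.
Proof.
move=> /andP[t0 t2pi]; apply/eqP => -[cost _].
have sin_half : 0 < sin (t / 2) by apply: sin_gt0_pi; lra.
have := cosD (t / 2) (t / 2); have := cos2Dsin2 (t / 2).
by rewrite -splitr cost; nra.
Qed.

Definition root1 (q : nat) : R[i] := cis (2 * pi / q%:R).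

Lemma cexp_root1 q r : cexp ('i%C * (2 * pi / q%:R * r%:R)%:C) = root1 q ^+ r.
Proof. by rewrite cexp_imaginary mulr_natr cisMn. Qed.

(** A quarter of the full turn is the angle [pi / 2]. This is where divisibility by 4 enters: it
    absorbs the phases of sigma products into powers of [root1 q]. *)
Lemma root1_quarter q : (0 < q)%N -> (4 %| q)%N -> root1 q ^+ (q %/ 4) = 'i%C.
Proof.
move=> q0 /divnK q4; rewrite -cisMn -cis_pihalf; congr cis.
rewrite -[in LHS]mulr_natr -{1}q4 natrM.
have : ((q %/ 4)%:R : R) != 0.
  by rewrite pnatr_eq0 -lt0n; move: q0; rewrite -{1}q4; case: (q %/ 4)%N.
by move=> ?; field.
Qed.

Lemma root1_prim q : (0 < q)%N -> q.-primitive_root (root1 q).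
Proof.
move=> q0; have qR : (0 : R) < q%:R by rewrite ltr0n.
have [|m mprim] := prim_order_exists q0 (_ : root1 q ^+ q = 1).
  rewrite -cisMn -[_ *+ q]mulr_natr divfK ?gt_eqF// mulr_natl mulr2n cisD /cis.
  rewrite cospi sinpi; apply/eqP; rewrite eq_complex /=.
  by apply/andP; split; apply/eqP; ring.
(* The exact order [m] divides [q]. If [m < q], the angle [2 pi m / q] lies strictly between 0 and
   [2 pi], so its [cis] cannot be 1. *)
move=> /[dup] /dvdn_leq -/(_ q0); rewrite leq_eqVlt => /predU1P[mq|mq] _.
  by rewrite -{1}mq.
have := prim_expr_order mprim; rewrite -cisMn => /eqP; apply: contraTT => _.
apply: cis_neq1; rewrite -[_ *+ m]mulr_natr; have pi0 := pi_gt0 R.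
have m0 : (0 : R) < m%:R by rewrite ltr0n (prim_order_gt0 mprim).
have pi2 : (0 : R) < 2 * pi by rewrite mulr_gt0.
rewrite mulr_gt0 ?divr_gt0//= mulrAC ltr_pdivrMr//.
by rewrite ltr_pM2l// ltr_nat.
Qed.

End UnitCircle.

(** * Products and proportionality of the sigma-matrices *)

Section SigmaMatrices.
Variable R : realType.
Local Notation sigma := (@sigma R).

Lemma mx2M (a b c d a' b' c' d' : R[i]) :
  mx2 a b c d *m mx2 a' b' c' d' =
  mx2 (a * a' + b * c') (a * b' + b * d') (c * a' + d * c') (c * b' + d * d').
Proof.
apply/matrixP => i j; rewrite !mxE !big_ord_recl big_ord0 !mxE /=.
by case: i => -[|[|[]]] //= ?; case: j => -[|[|[]]] //= ?; rewrite addr0.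
Qed.

Lemma mx2Z (x a b c d : R[i]) :
  x *: mx2 a b c d = mx2 (x * a) (x * b) (x * c) (x * d).
Proof.
apply/matrixP => i j; rewrite !mxE /=.
by case: i => -[|[|[]]] //= ?; case: j => -[|[|[]]].
Qed.

Lemma mx2_1 : 1%:M = mx2 1 0 0 1 :> 'M[R[i]]_2.
Proof.
apply/matrixP => i j; rewrite !mxE /=.
by case: i => -[|[|[]]] //= ?; case: j => -[|[|[]]].
Qed.

Lemma mx2_inj (a b c d a' b' c' d' : R[i]) :
  mx2 a b c d = mx2 a' b' c' d' -> [/\ a = a', b = b', c = c' & d = d'].
Proof.
move=> /matrixP e; move: (e 0 0) (e 0 1) (e 1 0) (e 1 1).
by rewrite !mxE.
Qed.

Lemma sqr_iC : 'i%C * 'i%C = -1 :> R[i].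
Proof. by rewrite -expr2 sqr_i. Qed.

(** The Pauli multiplication table. The sign of [- 'i] is written as ['i ^+ 3], so that every phase
    is a power of ['i]. *)
Lemma sigmaM (j k : 'I_4) :
  exists (n : nat) (l : 'I_4), sigma j *m sigma k = 'i%C ^+ n *: sigma l.
Proof.
have e n l a b c d : sigma l = mx2 a b c d -> forall M,
    M = mx2 ('i%C ^+ n * a) ('i%C ^+ n * b) ('i%C ^+ n * c) ('i%C ^+ n * d) ->
    exists (n : nat) (l : 'I_4), M = 'i%C ^+ n *: sigma l.
  by move=> sl M ->; exists n, l; rewrite sl mx2Z.
have s0 h : sigma (@Ordinal 4 0 h) = mx2 1 0 0 1 by rewrite /Defs.sigma /= mx2_1.
have s1 h : sigma (@Ordinal 4 1 h) = mx2 0 1 1 0 by [].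
have s2 h : sigma (@Ordinal 4 2 h) = mx2 0 (- 'i%C) 'i%C 0 by [].
have s3 h : sigma (@Ordinal 4 3 h) = mx2 1 0 0 (- 1) by [].
have i3 : 'i%C ^+ 3 = - 'i%C :> R[i] by rewrite exprS sqr_i mulrN1.
(* The table is read row by row: exponent 1 for the cyclic products 12, 23, 31, exponent 3 for the
   reversed ones, and 0 elsewhere. *)
case: j => -[|[|[|[|//]]]] hj; case: k => -[|[|[|[|//]]]] hk;
  rewrite ?(s0, s1, s2, s3) mx2M;
  [apply: (e 0%N _ _ _ _ _ (s0 isT))
  |apply: (e 0%N _ _ _ _ _ (s1 isT))
  |apply: (e 0%N _ _ _ _ _ (s2 isT))
  |apply: (e 0%N _ _ _ _ _ (s3 isT))
  |apply: (e 0%N _ _ _ _ _ (s1 isT))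
  |apply: (e 0%N _ _ _ _ _ (s0 isT))
  |apply: (e 1%N _ _ _ _ _ (s3 isT))
  |apply: (e 3%N _ _ _ _ _ (s2 isT))
  |apply: (e 0%N _ _ _ _ _ (s2 isT))
  |apply: (e 3%N _ _ _ _ _ (s3 isT))
  |apply: (e 0%N _ _ _ _ _ (s0 isT))
  |apply: (e 1%N _ _ _ _ _ (s1 isT))
  |apply: (e 0%N _ _ _ _ _ (s3 isT))
  |apply: (e 1%N _ _ _ _ _ (s2 isT))
  |apply: (e 3%N _ _ _ _ _ (s1 isT))
  |apply: (e 0%N _ _ _ _ _ (s0 isT))].
all: by rewrite !(mulr0, mul0r, mulr1, mul1r, addr0, add0r, mulrN, mulNr, opprK,
  oppr0, expr0, expr1, i3, sqr_iC).
Qed.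

Lemma sigma_sqr (j : 'I_4) : sigma j *m sigma j = 1%:M.
Proof.
case: j => -[|[|[|[|//]]]] hj; rewrite /Defs.sigma /= ?mulmx1// mx2M mx2_1;
  congr mx2; rewrite ?(mulrN, mulNr) ?sqr_iC; ring.
Qed.

(** The zero pattern separates the diagonal matrices (0, 3) from the antidiagonal ones (1, 2).
    Within each pair the ratio of the two nonzero entries differs by a sign. *)
Lemma sigma_scale_inj (a b : R[i]) (j k : 'I_4) :
  a != 0 -> a *: sigma j = b *: sigma k -> j = k /\ a = b.
Proof.
move=> a0; have neg_neq (x : R[i]) : x != 0 -> x = - x -> False.
  by move=> x0 /eqP; rewrite -addr_eq0 -mulr2n mulrn_eq0 (negPf x0).
have i0 : 'i%C != 0 :> R[i] by rewrite eq_complex /= oner_eq0 andbF.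
have ai0 : a * 'i%C != 0 by rewrite mulf_neq0.
case: j => -[|[|[|[|//]]]] hj; case: k => -[|[|[|[|//]]]] hk;
  rewrite /Defs.sigma /= ?mx2_1 !mx2Z => /mx2_inj[];
  rewrite ?(mulr0, mulr1, mulrN) => e1 e2 e3 e4.
all: try by move: (a0); rewrite ?(e1, e2) eqxx.
all: try by move: ai0; rewrite e3 eqxx.
all: try by split; [exact: val_inj | rewrite ?e1 ?e2].
all: try by split; [exact: val_inj | exact: (mulIf i0)].
(* The index pairs left are (0,3), (1,2), (2,1), (3,0); each makes a nonzero scalar equal to its
   opposite. *)
- by case: (neg_neq a); rewrite // {1}e1 e4 opprK.
- by case: (neg_neq a); rewrite // {1}e2 e3.
- by case: (neg_neq (a * 'i%C)); rewrite // e2 e3.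
- by case: (neg_neq a); rewrite // e4 e1.
Qed.

End SigmaMatrices.

(** * Group structure and order of the phase-shifted matrices *)

Section GsigmaGroup.
Variables (R : realType) (q : nat).
Hypotheses (q_gt0 : (0 < q)%N) (q4 : (4 %| q)%N).
Local Notation w := (root1 R q).
Local Notation G := (Gsigma R q).

(** Exponents of [w] only matter modulo [q]; allowing all naturals avoids reductions in the group
    laws. *)
Lemma mem_Gsigma (M : 'M[R[i]]_2) :
  M \in G <-> exists (j : 'I_4) (n : nat), M = w ^+ n *: sigma j.
Proof.
rewrite inE; split=> [[j [r ->]]|[j [n ->]]].
  by exists j, r; rewrite cexp_root1.
exists j, (Ordinal (ltn_pmod n q_gt0)).
by rewrite cexp_root1 (prim_expr_mod (root1_prim R q_gt0)).
Qed.

Lemma Gsigma_group : is_group (@mulmx R[i] 2 2 2) 1%:M G.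
Proof.
split.
- move=> _ _ /mem_Gsigma[j [m ->]] /mem_Gsigma[k [n ->]]; apply/mem_Gsigma.
  have [c [l sjk]] := sigmaM R j k; exists l, (m + n + q %/ 4 * c)%N.
  rewrite -scalemxAl -scalemxAr sjk !scalerA -(root1_quarter R q_gt0 q4).
  by rewrite -exprM -!exprD.
- by move=> x y z _ _ _; rewrite mulmxA.
- by apply/mem_Gsigma; exists 0, 0%N; rewrite expr0 scale1r.
- by move=> x _; rewrite mul1mx mulmx1.
(* Each [sigma j] is its own inverse, and [n + n * q.-1 = n * q] makes the phases cancel. *)
- move=> _ /mem_Gsigma[j [n ->]]; exists (w ^+ (n * q.-1) *: sigma j).
    by apply/mem_Gsigma; exists j, (n * q.-1)%N.
  have wn : w ^+ (n + n * q.-1) = 1.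
    by rewrite -mulnS prednK// mulnC exprM (prim_expr_order (root1_prim R q_gt0)) expr1n.
  rewrite -!scalemxAl -!scalemxAr sigma_sqr !scalerA -!exprD wn.
  by rewrite addnC wn scale1r.
Qed.

Lemma card_Gsigma : (G #= `I_(4 * q))%card.
Proof.
have wP := root1_prim R q_gt0.
have w0 : w != 0.
  by apply/eqP => w0; move: (prim_expr_order wP) => /eqP;
    rewrite w0 expr0n gtn_eqF//= eq_sym oner_eq0.
rewrite card_eq_sym.
(* Euclidean division of [n] by [q] encodes the pair: the quotient is the index, and [w ^+ n] sees
   only the remainder. For [n < 4 * q] the quotient is below 4, so [inord] never takes its default
   value. *)
apply: (@set_bij_card_eq _ _ _ _ (fun n => w ^+ n *: @sigma R (inord (n %/ q)))).
split.
- move=> n _; suff : w ^+ n *: @sigma R (inord (n %/ q)) \in G by rewrite inE.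
  by apply/mem_Gsigma; exists (inord (n %/ q)), n.
- move=> m n; rewrite !inE /= -!ltn_divLR// => mq nq.
  move=> /sigma_scale_inj[|/(congr1 val)]; first by rewrite expf_neq0.
  rewrite /= !inordK// => mn_div /eqP; rewrite (eq_prim_root_expr wP) => /eqP mn_mod.
  by rewrite (divn_eq m q) (divn_eq n q) mn_div mn_mod.
- move=> _ [j [r ->]]; exists (j * q + r)%N => /=.
    by rewrite -ltn_divLR// divnMDl// divn_small// addn0.
  rewrite divnMDl// divn_small// addn0 inord_val cexp_root1.
  by rewrite exprD mulnC exprM (prim_expr_order wP) expr1n mul1r.
Qed.

End GsigmaGroup.

Lemma isomorphic_card_eq (T U : Type) (opT : T -> T -> T) (opU : U -> U -> U)
  (G : set T) (H : set U) : isomorphic opT opU G H -> (G #= H)%card.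
Proof. by case=> f fbij _; exact: set_bij_card_eq fbij. Qed.

Theorem proposition6p2 (R : realType) :
  [/\ Q12 =i [:: 4; 8; 12; 20; 24; 36; 40; 60; 72; 120; 180; 360]%N,
      forall q : nat, q \in Q12 ->
        is_group (@mulmx R[i] 2 2 2) 1%:M (Gsigma R q) /\
        (Gsigma R q #= `I_(4 * q))%card
    & forall q q' : nat, q \in Q12 -> q' \in Q12 -> q <> q' ->
        ~ isomorphic (@mulmx R[i] 2 2 2) (@mulmx R[i] 2 2 2)
            (Gsigma R q) (Gsigma R q')].
Proof.
have Q12P q : q \in Q12 -> (0 < q)%N /\ (4 %| q)%N by case: q => // q /andP[].
have cardG q : q \in Q12 -> (Gsigma R q #= `I_(4 * q))%card.
  by move=> /Q12P[q_gt0 q4]; exact: card_Gsigma.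
split=> [||q q' qQ q'Q neq_qq' /isomorphic_card_eq GG'].
- exact: mem_Q12.
- move=> q qQ; split; last exact: cardG.
  by have [q_gt0 q4] := Q12P q qQ; exact: Gsigma_group.
(* Only the bijection underlying the isomorphism is used: it forces [4 * q = 4 * q']. *)
- apply/neq_qq'/eqP; rewrite -(eqn_pmul2l (isT : (0 < 4)%N)).
  apply/eqP/card_eq_II.
  by apply: card_eq_trans (cardG _ q'Q); apply: card_eq_trans GG'; rewrite card_eq_sym cardG.
Qed.
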